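(* Let $n\in\mathbb{N}$, $n>0$, and let $f\in F(\{0,1\},n)$ be conservative. Then there exist $m\in\mathbb{N}$, $m>0$, $a\in\mathbb{Z}$, and $g\in F(\mathbb{Z},m)$ such that (i) for every $s\in\tilde{X}(\mathbb{Z})$, $g_{\infty,a}(s)\in\tilde{X}(\mathbb{Z})$; (ii) $\phi\circ g_{\infty,a}=f_\infty\circ\phi$ as maps from $\tilde{X}(\mathbb{Z})$ to $X(\{0,1\})$.
   Context: For a countable set $\mathcal{G}$: $X(\mathcal{G})=\mathcal{G}^{\mathbb{Z}}$ is the set of bisequences over $\mathcal{G}$, with $x_i=x(i)$. For $n\in\mathbb{N}$, $n>0$, $\mathcal{B}_n(\mathcal{G})$ is the set of $n$-blocks $x_1x_2\ldots x_n$ with $x_i\in\mathcal{G}$ (i.e. $\mathcal{G}^n$), and $F(\mathcal{G},n)$ is the set of all mappings $\mathcal{B}_n(\mathcal{G})\to\mathcal{G}$ (local mappings). For $f\in F(\mathcal{G},n)$ and $a\in\mathbb{Z}$, the mapping $f_{\infty,a}:X(\mathcal{G})\to X(\mathcal{G})$ is defined by $f_{\infty,a}(x)=y$, where $y_i=f(x_{i-a},x_{i+1-a},\ldots,x_{i+n-1-a})$ for all $i\in\mathbb{Z}$; and $f_\infty=f_{\infty,0}$. A bisequence $x$ is $L$-periodic ($L\in\mathbb{N}$, $L>0$) if $x_{i+L}=x_i$ for all $i\in\mathbb{Z}$. A local mapping $f\in F(\{0,1\},n)$ is $L$-conservative if $\sum_{i=1}^{L}f(x_i,x_{i+1},\ldots,x_{i+n-1})=\sum_{i=1}^{L}x_i$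 for every $L$-periodic $x\in X(\{0,1\})$ (sums taken in $\mathbb{Z}$), and it is conservative if it is $L$-conservative for every $L>0$. $\tilde{X}(\mathbb{Z})\subset X(\mathbb{Z})$ is the set of increasing bisequences, i.e. strictly increasing functions $s:\mathbb{Z}\to\mathbb{Z}$. The mapping $\phi:\tilde{X}(\mathbb{Z})\to X(\{0,1\})$ is defined by $\phi(s)=x$, where $x_i=1$ if there exists $k\in\mathbb{Z}$ with $s_k=i$, and $x_i=0$ otherwise. *)

(* Defs.v *)
From mathcomp Require Import all_boot all_order all_algebra.
From mathcomp Require Import boolp.

Set Implicit Arguments.
Unset Strict Implicit.
Unset Printing Implicit Defensive.

Import Order.TTheory GRing.Theory Num.Theory.

Local Open Scope ring_scope.

(* Symbols 0 and 1 of the binary alphabet are [false] and [true]. *)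

Definition bisequence (G : Type) : Type := int -> G.

Definition local_map (G : Type) (n : nat) : Type := n.-tuple G -> G.

(* The block x_i x_(i+1) ... x_(i+n-1). *)
Definition block_at (G : Type) (n : nat) (x : bisequence G) (i : int) :
    n.-tuple G :=
  [tuple x (i + (j : nat)%:Z) | j < n].

Definition global_map_shift (G : Type) (n : nat) (f : local_map G n) (a : int)
    (x : bisequence G) : bisequence G :=
  fun i => f (block_at n x (i - a)).

Definition global_map (G : Type) (n : nat) (f : local_map G n) :
    bisequence G -> bisequence G :=
  global_map_shift f 0.

Definition periodic (G : Type) (L : nat) (x : bisequence G) : Prop :=
  forall i : int, x (i + L%:Z) = x i.

Definition L_conservative (n : nat) (L : nat) (f : local_map bool n) : Prop :=
  forall x : bisequence bool, periodic L x ->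
    \sum_(1 <= i < L.+1) (f (block_at n x i%:Z) : nat)%:Z
    = \sum_(1 <= i < L.+1) (x i%:Z : nat)%:Z.

Definition conservative (n : nat) (f : local_map bool n) : Prop :=
  forall L : nat, (0 < L)%N -> L_conservative L f.

Definition increasing (s : bisequence int) : Prop :=
  forall i j : int, i < j -> s i < s j.

(* Defined on all integer bisequences; only meant for increasing ones. *)
Definition phi (s : bisequence int) : bisequence bool :=
  fun i => `[< exists k : int, s k = i >].

(* Main.v *)
Require Import Defs.
From mathcomp Require Import all_boot all_order all_algebra.
From mathcomp Require Import boolp zify.

(* For a conservative [f] the Hattori-Takesue flux [J] across the bond
   [(i, i + 1)], which depends on [x_(i+1) ... x_(i+n-1)] only, satisfies
   [f_oo(x)_i = x_i + J_i - J_(i-1)]. If [N i] is the index of the last particle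
   of [s] at a site [<= i], then [M = N + J] increases by exactly [f_oo(x)_i] at
   [i], so it numbers the particles of the image configuration by [int]. As
   [0 <= J <= n], the [k]-th image particle lies in [(s_(k-n-1), s_k]], and there
   [M - k] and the image are determined by [s_(k-n-1), ..., s_(k+n)]: this block
   determines the new position of the [k]-th particle. *)

Set Implicit Arguments.
Unset Strict Implicit.
Unset Printing Implicit Defensive.

Import Order.TTheory GRing.Theory Num.Theory.

Local Open Scope ring_scope.

(** * Conservation for finitely supported configurations *)

Lemma eq_block_at (G : Type) (n : nat) (x y : bisequence G) (i i' : int) :
  (forall j : nat, (j < n)%N -> x (i + j%:Z) = y (i' + j%:Z)) ->
  block_at n x i = block_at n y i'.
Proof. by move=> xy; apply: eq_from_tnth => j; rewrite !tnth_mktuple xy. Qed.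

Lemma block_at_inj (G : Type) (n : nat) (x y : bisequence G) (i i' : int) :
  block_at n x i = block_at n y i' ->
  forall j : nat, (j < n)%N -> x (i + j%:Z) = y (i' + j%:Z).
Proof.
move=> e j jn; have := congr1 (fun w => tnth w (Ordinal jn)) e.
by rewrite !tnth_mktuple.
Qed.

Lemma conservative_block0 (n : nat) (f : local_map bool n) :
  conservative f -> forall i : int, f (block_at n (fun=> false) i) = false.
Proof.
move=> /(_ 1%N isT (fun=> false)) /(_ (fun _ => erefl)).
rewrite !big_nat1 => f0 i.
rewrite (@eq_block_at _ n _ (fun=> false) i 1%:Z) //.
by move: f0; case: (f _).
Qed.

(** In the repetition with period [3 * n], a block that leaves [1, ..., 3 * n] reaches only empty
    sites among the first [n] of the next copy, so [f] sees the same block as in [z]. *)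
Lemma conservative_finite_support (n : nat) (f : local_map bool n)
    (z : bisequence bool) :
  (0 < n)%N -> conservative f ->
  (forall j : int, z j -> n%:Z < j <= n%:Z *+ 2) ->
  \sum_(1 <= j < (3 * n).+1) (f (block_at n z j%:Z) : nat)%:Z
  = \sum_(1 <= j < (3 * n).+1) (z j%:Z : nat)%:Z.
Proof.
move=> n_gt0 f_cons suppz; pose L := (3 * n)%N.
have z0 j : ~~ (n%:Z < j <= n%:Z *+ 2) -> z j = false.
  by move=> /negP nj; apply/negP => /suppz.
pose p : bisequence bool := fun j => z (((j - 1) %% L%:Z)%Z + 1).
have pz (j : int) : 1 <= j <= L%:Z -> p j = z j.
  by move=> jL; rewrite /p modz_small ?subrK //; lia.
have pL : periodic L p.
  by move=> j; rewrite /p (_ : j + L%:Z - 1 = j - 1 + L%:Z) ?modzDr //; lia.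
have := f_cons L _ p pL; rewrite -/L => /(_ ltac:(lia)).
rewrite (eq_big_nat _ _ (F2 := fun j => (f (block_at n z j%:Z) : nat)%:Z)); last first.
  move=> j jL; rewrite (@eq_block_at _ _ p z j%:Z j%:Z) // => k kn.
  have [jk|jk] := leqP (j + k) L; first by apply: pz; lia.
  have -> : j%:Z + k%:Z = (j + k - L)%N%:Z + L%:Z by lia.
  by rewrite pL pz ?z0 //; lia.
move=> ->; apply: eq_big_nat => j jL; rewrite pz //; lia.
Qed.

(** * The flux and its balance equation *)

Definition truncate (x : bisequence bool) (i : int) : bisequence bool :=
  fun j => (i < j) && x j.

(* Number of particles that cross from the right of [i] to a site [<= i] when
   all the sites [<= i] are initially empty. *)
Definition flux (n : nat) (f : local_map bool n) (x : bisequence bool) (i : int) :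
    int :=
  \sum_(0 <= j < n) (f (block_at n (truncate x i) (i - j%:Z)) : nat)%:Z.

Lemma flux_bounds (n : nat) (f : local_map bool n) x i :
  0 <= flux f x i <= n%:Z.
Proof.
rewrite /flux sumr_ge0 //=.
apply: (le_trans (y := \sum_(0 <= j < n) 1)).
  by apply: ler_sum => j _; case: (f _).
by rewrite big_const_nat iter_addr_0 subn0; lia.
Qed.

Lemma eq_flux (n : nat) (f : local_map bool n) x y i :
  (forall j : int, i < j < i + n%:Z -> x j = y j) -> flux f x i = flux f y i.
Proof.
move=> xy; apply: eq_big_nat => j jn; congr (Posz (nat_of_bool (f _))).
apply: eq_block_at => k kn; rewrite /truncate.
by case: ltP => //= ik; apply: xy; lia.
Qed.

(* Conservation is compared on the words [0^n x_i ... x_(i+n-1) 0^n] and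
   [0^n 0 x_(i+1) ... x_(i+n-1) 0^n]. *)
Lemma flux_balance (n : nat) (f : local_map bool n) (x : bisequence bool) i :
  (0 < n)%N -> conservative f ->
  (f (block_at n x i) : nat)%:Z + flux f x (i - 1)
  = (x i : nat)%:Z + flux f x i.
Proof.
move=> n_gt0 f_cons.
(* Site [n + 1] of [z d] carries [x i] if [d = 0] and is erased if [d = 1]. *)
pose z (d : nat) : bisequence bool :=
  fun j => ((n + d)%N%:Z < j <= (n + n)%N%:Z) && x (i + (j - n%:Z - 1)).
pose y d (j : nat) : int := (f (block_at n (z d) j%:Z) : nat)%:Z.
have y_total d : \sum_(1 <= j < (3 * n).+1) y d j
    = \sum_(1 <= j < (3 * n).+1) (z d j%:Z : nat)%:Z.
  by apply: conservative_finite_support => // j /andP[+ _]; lia.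
(* Blocks starting at [1, ..., d] see no particle; the next [n] blocks are those of the flux in
   reverse order, and [d <= 1] keeps them within the cut at [n + n]. *)
have y_head d : (d <= 1)%N ->
    \sum_(1 <= j < (n + d).+1) y d j = flux f x (i - 1 + d%:Z).
  move=> d1; rewrite (@big_cat_nat _ _ _ d.+1) //=; last lia.
  rewrite big_nat big1 ?add0r => [|j jd]; last first.
    rewrite /y (@eq_block_at _ _ (z d) (fun=> false) _ 0).
      by rewrite conservative_block0.
    by move=> k kn; apply/negbTE; rewrite /z; lia.
  rewrite -(add0n d.+1) big_addn (_ : _ - _ = n)%N; last lia.
  rewrite /flux [RHS]big_nat_rev; apply: eq_big_nat => j jn.
  congr (Posz (nat_of_bool (f _))); apply: eq_block_at => k kn.
  by rewrite /z /truncate; congr (_ && x _); lia.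
(* [z 0] and [z 1] can differ only at site [n + 1], which these blocks miss. *)
have y_tail : \sum_(n.+2 <= j < (3 * n).+1) y 0%N j
    = \sum_(n.+2 <= j < (3 * n).+1) y 1%N j.
  apply: eq_big_nat => j jn; congr (Posz (nat_of_bool (f _))).
  by apply: eq_block_at => k kn; rewrite /z; congr (_ && _); lia.
have y_mid : y 0%N n.+1 = (f (block_at n x i) : nat)%:Z.
  congr (Posz (nat_of_bool (f _))); apply: eq_block_at => k kn; rewrite /z.
  by rewrite andb_idl => [|_]; [congr x|]; lia.
have z_total : \sum_(1 <= j < (3 * n).+1) (z 0%N j%:Z : nat)%:Z
    = (x i : nat)%:Z + \sum_(1 <= j < (3 * n).+1) (z 1%N j%:Z : nat)%:Z.
  rewrite (bigD1_seq n.+1) ?mem_index_iota ?iota_uniq //=; last lia.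
  rewrite [in RHS](bigD1_seq n.+1) ?mem_index_iota ?iota_uniq //=; last lia.
  congr (_ + _).
    rewrite /z andb_idl => [|_]; last lia.
    by congr (Posz (nat_of_bool (x _))); lia.
  rewrite (_ : z 1%N n.+1 = false) ?add0r; last by apply/negbTE; rewrite /z; lia.
  apply: eq_bigr => j jn; congr (Posz (nat_of_bool _)).
  by rewrite /z; congr (_ && _); lia.
move: z_total; rewrite -!y_total.
rewrite !(@big_cat_nat _ _ _ n.+2 1%N (3 * n).+1) //=; try lia.
rewrite y_tail big_nat_recr //= y_mid.
have := y_head 0%N isT; have := y_head 1%N isT.
rewrite addn0 addn1 addr0 subrK => -> ->.
by rewrite addrA [_ + flux f x (i - 1)]addrC => /addIr.
Qed.

(** * Increasing integer sequences and floor indices *)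

Lemma int_crossing (P : pred int) (a b : int) :
  a <= b -> ~~ P a -> P b -> exists2 i, a < i <= b & P i && ~~ P (i - 1).
Proof.
move=> ab; have [d ->] : exists d : nat, b = a + d%:Z by exists `|b - a|%N; lia.
elim: d => [|d IHd] Pa Pb; first by rewrite addr0 (negbTE Pa) in Pb.
case Pd: (P (a + d%:Z)).
  by have [i ai Pi] := IHd Pa Pd; exists i => //; lia.
exists (a + d.+1%:Z); first lia.
by rewrite Pb (_ : _ - 1 = a + d%:Z) ?Pd //; lia.
Qed.

Lemma increasing_leE (s : bisequence int) :
  increasing s -> forall i j : int, (s i <= s j) = (i <= j).
Proof.
move=> si i j; case: (ltgtP i j) => [ij|ji|->]; last exact: lexx.
  exact/ltW/si.
by apply/negbTE; rewrite -ltNge si.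
Qed.

(** Integer values rise by at least one per step; in particular [s] is unbounded in both
    directions. *)
Lemma increasing_add (s : bisequence int) (k : int) (d : nat) :
  increasing s -> s k + d%:Z <= s (k + d%:Z).
Proof.
move=> si; elim: d => [|d IHd]; first by rewrite !addr0.
by have := si (k + d%:Z) (k + d.+1%:Z) ltac:(lia); lia.
Qed.

Lemma increasing_floor (s : bisequence int) (i : int) :
  increasing s -> exists q : int, s q <= i < s (q + 1).
Proof.
move=> si; have [K iK] : exists K : nat, - K%:Z <= i - s 0 <= K%:Z.
  by move: (s 0) => b; exists `|i - b|%N; lia.
have lo := increasing_add (- K%:Z) K si; rewrite addNr in lo.
have hi := increasing_add 0 K.+1 si; rewrite add0r in hi.
move: (s 0) iK lo hi => b iK lo hi.
have [||| q] := @int_crossing (fun q => i < s q) (- K%:Z) K.+1%:Z.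
- by lia.
- by rewrite -leNgt; lia.
- by lia.
move=> _ /andP[iq]; rewrite -leNgt => qi.
by exists (q - 1); rewrite subrK qi iq.
Qed.

Lemma increasing_floor_uniq (s : bisequence int) (i q q' : int) :
  increasing s -> s q <= i < s (q + 1) -> s q' <= i < s (q' + 1) -> q = q'.
Proof.
move=> si /andP[h1 h2] /andP[h3 h4].
have := increasing_leE si (q' + 1) q; have := increasing_leE si (q + 1) q'.
lia.
Qed.

(** * Labelling of the image particles *)

(* The [k]-th particle of [s], in the order-preserving labelling determined by
   the flux, is sent to [i]; [q] is the label of the last particle of [s] at a
   site [<= i]. *)
Definition sent_to (n : nat) (f : local_map bool n) (s : bisequence int)
    (k i : int) : Prop :=
  f (block_at n (phi s) i) /\
  exists2 q, s q <= i < s (q + 1) & q + flux f (phi s) i = k.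

(** Together with [flux_balance], this makes floor index plus flux a count of the image
    particles. *)
Lemma phi_floor_step (s : bisequence int) (i q q' : int) :
  increasing s -> s q <= i < s (q + 1) -> s q' <= i - 1 < s (q' + 1) ->
  q = q' + (phi s i : nat)%:Z.
Proof.
move=> si qi q'i; rewrite /phi; case: asboolP => [[k ki]|nk] /=.
  suff [-> ->] : q = k /\ q' = k - 1 by rewrite subrK.
  have := si k (k + 1) ltac:(lia); have := si (k - 1) k ltac:(lia) => h1 h2.
  split; first by apply: (increasing_floor_uniq si qi); lia.
  by apply: (increasing_floor_uniq si q'i); rewrite subrK; lia.
rewrite addr0; apply: (increasing_floor_uniq si qi).
have qi1 : s (q' + 1) != i by apply/eqP => h; apply: nk; exists (q' + 1).
lia.
Qed.

Lemma output_label (n : nat) (f : local_map bool n) (s : bisequence int) :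
  (0 < n)%N -> conservative f -> increasing s ->
  exists M : int -> int,
  [/\ forall i : int, M i = M (i - 1) + (f (block_at n (phi s) i) : nat)%:Z,
      forall i k : int, sent_to f s k i <-> f (block_at n (phi s) i) /\ M i = k
    & forall k : int, M (s (k - n%:Z - 1)) < k <= M (s k)].
Proof.
move=> n_gt0 f_cons si.
have [N sN] := choice (fun i => increasing_floor i si).
have Ns k : N (s k) = k.
  by apply: (increasing_floor_uniq si (sN _)); rewrite lexx si //; lia.
exists (fun i => N i + flux f (phi s) i); split.
- move=> i; rewrite (phi_floor_step si (sN i) (sN (i - 1))).
  by have := flux_balance (phi s) i n_gt0 f_cons; lia.
- move=> i k; split=> [[fi [q qi <-]]|[fi <-]].
    by rewrite (increasing_floor_uniq si (sN i) qi).
  by split=> //; exists (N i).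
(* As [N (s k) = k], a nonnegative flux gives the upper bound on [k], and a flux of at most [n] the
   strict lower one. *)
- move=> k; rewrite !Ns.
  have := flux_bounds f (phi s) (s k).
  have := flux_bounds f (phi s) (s (k - n%:Z - 1)).
  lia.
Qed.

Lemma nondecreasing_count (y : bisequence bool) (M : int -> int) :
  (forall i : int, M i = M (i - 1) + (y i : nat)%:Z) ->
  forall i j : int, i <= j -> M i <= M j.
Proof.
move=> Mstep i j ij; have -> : j = i + `|j - i|%N%:Z by lia.
elim: `|j - i|%N => [|d IHd]; first by rewrite addr0.
apply: le_trans IHd _; rewrite [leRHS]Mstep.
by rewrite (_ : i + d.+1%:Z - 1 = i + d%:Z) ?lerDl //; lia.
Qed.

Lemma sent_to_range (n : nat) (f : local_map bool n) (s : bisequence int)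
    (k i : int) :
  (0 < n)%N -> conservative f -> increasing s ->
  sent_to f s k i -> s (k - n%:Z - 1) < i <= s k.
Proof.
move=> n_gt0 f_cons si.
have [M [Mstep sentM Ms]] := output_label n_gt0 f_cons si.
have Mle := nondecreasing_count Mstep.
move=> /sentM[fi Mi]; have /andP[lo hi] := Ms k.
apply/andP; split.
  by rewrite ltNge; apply/negP => h; have := Mle _ _ h; lia.
(* An image particle at [i > s k] would force [M i > M (i - 1) >= M (s k) >= k]. *)
rewrite leNgt; apply/negP => h; have := Mle (s k) (i - 1) ltac:(lia); have := Mstep i.
by rewrite fi; lia.
Qed.

Lemma sent_to_lt (n : nat) (f : local_map bool n) (s : bisequence int)
    (k k' i i' : int) :
  (0 < n)%N -> conservative f -> increasing s ->
  sent_to f s k i -> sent_to f s k' i' -> k < k' -> i < i'.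
Proof.
move=> n_gt0 f_cons si.
have [M [Mstep sentM Ms]] := output_label n_gt0 f_cons si.
have Mle := nondecreasing_count Mstep.
move=> /sentM[_ <-] /sentM[_ <-]; rewrite !ltNge; apply: contra; exact: Mle.
Qed.

(** [M] equals [k - 1] just before any site that receives [k], so two such sites contradict
    monotonicity. *)
Lemma sent_to_uniq (n : nat) (f : local_map bool n) (s : bisequence int)
    (k i i' : int) :
  (0 < n)%N -> conservative f -> increasing s ->
  sent_to f s k i -> sent_to f s k i' -> i = i'.
Proof.
move=> n_gt0 f_cons si.
have [M [Mstep sentM Ms]] := output_label n_gt0 f_cons si.
have Mle := nondecreasing_count Mstep.
move=> /sentM[fi Mi] /sentM[fi' Mi'].
have := Mstep i; have := Mstep i'; rewrite fi fi' Mi Mi' /= => h1 h2.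
case: (ltgtP i i') => // ii'.
  by have := Mle i (i' - 1) ltac:(lia); lia.
by have := Mle i' (i - 1) ltac:(lia); lia.
Qed.

(** [M] climbs from below [k] to at least [k] by steps of at most one, so at the crossing it equals
    [k] and an image particle sits there. *)
Lemma sent_to_total (n : nat) (f : local_map bool n) (s : bisequence int)
    (k : int) :
  (0 < n)%N -> conservative f -> increasing s ->
  exists i, sent_to f s k i.
Proof.
move=> n_gt0 f_cons si.
have [M [Mstep sentM Ms]] := output_label n_gt0 f_cons si.
have /andP[lo hi] := Ms k.
have [] := @int_crossing (fun i => k <= M i) (s (k - n%:Z - 1)) (s k).
- by rewrite increasing_leE //; lia.
- by rewrite -ltNge.
- by [].
move=> i _ /andP[ki ik]; exists i; apply/sentM.
by have := Mstep i; case: (f _) => /=; lia.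
Qed.

Lemma sent_to_onto (n : nat) (f : local_map bool n) (s : bisequence int)
    (i : int) :
  (0 < n)%N -> conservative f -> increasing s ->
  f (block_at n (phi s) i) -> exists k, sent_to f s k i.
Proof.
move=> n_gt0 f_cons si.
have [M [_ sentM _]] := output_label n_gt0 f_cons si.
by move=> fi; exists (M i); apply/sentM.
Qed.

(** * Locality of the labelling *)

(** Every particle between the end particles of a block is an entry of that block. The converse
    implication comes from exchanging [s] and [s']. *)
Lemma eq_phi_window (s s' : bisequence int) (a a' : int) (m : nat) (i : int) :
  increasing s -> block_at m.+1 s a = block_at m.+1 s' a' ->
  s a <= i <= s (a + m%:Z) -> phi s i -> phi s' i.
Proof.
move=> si /block_at_inj e /andP[ai im] /asboolP[k ki]; apply/asboolP.
move: ai im; rewrite -ki !increasing_leE // => ak km.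
exists (a' + `|k - a|%N%:Z); rewrite -e; last lia.
by congr s; lia.
Qed.

Lemma sent_to_local (n : nat) (f : local_map bool n) (s s' : bisequence int)
    (k k' i : int) :
  (0 < n)%N -> conservative f -> increasing s -> increasing s' ->
  block_at (n + n).+2 s (k - n%:Z - 1) = block_at (n + n).+2 s' (k' - n%:Z - 1) ->
  sent_to f s k i -> sent_to f s' k' i.
Proof.
move=> n_gt0 f_cons si si' e sent; have e' := block_at_inj e.
have /andP[ilo ihi] := sent_to_range n_gt0 f_cons si sent.
have ss' (j : int) : - n%:Z - 1 <= j <= n%:Z -> s (k + j) = s' (k' + j).
  move=> jn; have := e' `|(j + n%:Z + 1)%R|%N ltac:(lia).
  by rewrite (_ : k - _ - _ + _ = k + j) 1?(_ : k' - _ - _ + _ = k' + j) //; lia.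
have hlo := ss' (- n%:Z - 1) ltac:(lia); have hhi := ss' n%:Z ltac:(lia).
rewrite !addrA in hlo.
(* The [n] sites read from [i <= s k] end before [s (k + n)], so the block covers them. *)
have sn := increasing_add k n si.
have eq_phi (j : int) : i <= j < i + n%:Z -> phi s j = phi s' j.
  move=> ji; have js : s (k - n%:Z - 1) <= j <= s (k + n%:Z) by lia.
  have endE (l : int) : l - n%:Z - 1 + (n + n).+1%:Z = l + n%:Z by lia.
  apply/idP/idP; first by apply: (eq_phi_window si e); rewrite endE.
  by apply: (eq_phi_window si' (esym e)); rewrite endE -hlo -hhi.
case: sent => fi [q qi qk]; split.
  rewrite -(@eq_block_at _ n (phi s) _ i) // => j jn.
  by apply: eq_phi; lia.
(* [q] lies between [k - n - 1] and [k], so [s q] and [s (q + 1)] are entries of the block. *)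
have qlo : k - n%:Z - 1 < q + 1 by rewrite ltNge -(increasing_leE si) -ltNge; lia.
have qhi : q <= k by rewrite -(increasing_leE si); lia.
exists (k' + (q - k)).
  rewrite -addrA -!ss'; try lia.
  by rewrite (_ : k + (q - k) = q) 1?(_ : k + (q - k + 1) = q + 1) //; lia.
rewrite -(@eq_flux _ f (phi s)); first lia.
by move=> j ji; apply: eq_phi; lia.
Qed.

Theorem theorem4p2 (n : nat) (n_gt0 : (0 < n)%N) (f : local_map bool n)
    (f_cons : conservative f) :
  exists (m : nat) (a : int) (g : local_map int m),
    [/\ (0 < m)%N,
        forall s : bisequence int,
          increasing s -> increasing (global_map_shift g a s)
      & forall s : bisequence int,
          increasing s -> phi (global_map_shift g a s) = global_map f (phi s)].
Proof.
(* Entries of [w] are absolute positions, so one target [i] serves all [s] and [k] showing [w]. *)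
have ex_g (w : (n + n).+2.-tuple int) : exists i, forall (s : bisequence int) k,
    increasing s -> block_at (n + n).+2 s (k - n%:Z - 1) = w -> sent_to f s k i.
  have [[s [k [si sw]]]|now] := EM (exists s k,
      increasing s /\ block_at (n + n).+2 s (k - n%:Z - 1) = w); last first.
    (* Blocks that occur in no increasing bisequence get the dummy value [0]. *)
    by exists 0 => s k si sw; case: now; exists s, k.
  have [i sent] := sent_to_total k n_gt0 f_cons si.
  exists i => s' k' si' s'w.
  by apply: sent_to_local sent => //; rewrite sw s'w.
have [g gP] := choice ex_g.
(* The shift [n + 1] makes the block read at [k] start at label [k - n - 1]. *)
have {}gP s k : increasing s -> sent_to f s k (global_map_shift g (n%:Z + 1) s k).
  by move=> si; apply: gP; rewrite // opprD addrA.
exists (n + n).+2, (n%:Z + 1), g; split=> // s si.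
  by move=> k k'; apply: (sent_to_lt n_gt0 f_cons si); exact: gP.
apply: funext => i; rewrite /global_map {2}/global_map_shift subr0.
apply/asboolP/idP => [[k <-]|fi]; first by case: (gP s k si).
have [k sent] := sent_to_onto n_gt0 f_cons si fi.
by exists k; exact: sent_to_uniq (gP s k si) sent.
Qed.
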